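(* Let $\Gamma^1=(G,\sigma_1,\mu_1)$ be a $\gamma_1$-regular signed graph on $n_1$ vertices and $m_1$ edges, let $\theta$ be any $r$-orientation of the edges of $\Gamma^1$, and let $\Gamma^2=(H,\sigma_2,\mu_2)$ be an arbitrary signed graph on $n_2$ vertices. Let $\lambda_1(L(\Gamma^1)),\dots,\lambda_{n_1}(L(\Gamma^1))$ be the eigenvalues of $L(\Gamma^1)$. If $\lambda$ is not a pole of $\Sigma_{L(\Gamma^2)}(\lambda-\gamma_1)$, then $$f_{L((\Gamma^1\boxdot\Gamma^2)_\theta)}(\lambda)=(\lambda-2-2n_2)^{m_1-n_1}\big(f_{L(\Gamma^2)}(\lambda-\gamma_1)\big)^{n_1}\prod_{j=1}^{n_1}\Big[\lambda^2-(\gamma_1+2+2n_2)\lambda+2\gamma_1(n_2+1)-\big(1+(\lambda-\gamma_1)\Sigma_{L(\Gamma^2)}(\lambda-\gamma_1)\big)\big(2\gamma_1-\lambda_j(L(\Gamma^1))\big)\Big].$$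
   Context: A signed graph $\Gamma=(G,\sigma,\mu)$ has a finite simple graph $G$ with vertices $v_1,\dots,v_n$, signature $\sigma:E(G)\to\{\pm1\}$ and marking $\mu:V(G)\to\{\pm1\}$; $\mu(\Gamma)=(\mu(v_1),\dots,\mu(v_n))^T$. $A(\Gamma)$ has $(i,j)$ entry $\sigma(v_iv_j)$ if $v_i\sim v_j$ and $0$ otherwise; $D(\Gamma)$ is the diagonal matrix of (unsigned) degrees; $L(\Gamma)=D(\Gamma)-A(\Gamma)$. $\gamma$-regular means all degrees equal $\gamma$. $f_M(\lambda)=\det(\lambda I-M)$. The signed $N$-coronal is the rational function $\Sigma_N(X)=\mu(\Gamma)^T(XI_n-N)^{-1}\mu(\Gamma)$. An $r$-orientation of $(G,\sigma)$ is a map $\theta:V(G)\times E(G)\to\{-1,0,1\}$ with $\theta(w,uv)=0$ for $w\notin\{u,v\}$, $\theta(u,uv)\in\{\pm1\}$ at endpoints, and $\theta(u,uv)\theta(v,uv)=\sigma(uv)$. The subdivision graph $S(\Gamma^1_\theta)$ is obtained by inserting a new vertex $v_e$ into each edge $e$ of $\Gamma^1$, the edge $v_iv_e$ having sign $\theta(v_i,e)$. With $V(\Gamma^1)=\{v_1,\dots,v_{n_1}\}$, the subdivision vertex neighbourhood corona $(\Gamma^1\boxdot\Gamma^2)_\theta$ is obtained from $S(\Gamma^1_\theta)$ and $n_1$ disjoint copies of $\Gamma^2$ by joining, for each $t$, every inserted vertex $v_e$ with $e$ incident to $v_t$ to every vertex $u$ of the $t$-th copy, with sign $\theta(v_t,e)\mu_2(u)$,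 where $\mu_2(u)$ is the marking of the corresponding vertex of $\Gamma^2$. The Laplacian of the product uses its own degrees.
   Formalization: The formal statement additionally assumes that λ ≠ 2+2n₂ or m₁ ≥ n₁, since otherwise (γ₁ = 0 or 1 and λ = 2+2n₂) the factor (λ−2−2n₂)^{m₁−n₁} is zero to a negative power and the right-hand side is undefined. *)

(* Defs.v *)
From HB Require Import structures.
From mathcomp Require Import all_boot all_order all_algebra.
From mathcomp Require Import fraction generic_quotient.

Set Implicit Arguments.
Unset Strict Implicit.
Unset Printing Implicit Defensive.

Import Order.TTheory GRing.Theory Num.Theory.
Local Open Scope ring_scope.

Definition is_sign (x : int) : bool := (x == 1) || (x == -1).

(* The pair (G, sigma).  The signature of the edge uv is sigma u v; its value
   on non-adjacent pairs is irrelevant. *)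
Record signed_graph (V : finType) := SignedGraph {
  adj : rel V;
  sigma : V -> V -> int;
  adj_sym : symmetric adj;
  adj_irrefl : irreflexive adj;
  sigma_sym : forall u v, sigma u v = sigma v u;
  sigma_sign : forall u v, adj u v -> is_sign (sigma u v)
}.

(* The triple (G, sigma, mu). *)
Record marked_graph (V : finType) := MarkedGraph {
  mg_graph :> signed_graph V;
  mark : V -> int;
  mark_sign : forall v, is_sign (mark v)
}.

Section Graph.

Variables (V : finType) (G : signed_graph V).

Definition edges : {set {set V}} :=
  [set e | [exists u, exists v, adj G u v && (e == [set u; v])]].

Definition edge : finType := {e : {set V} | e \in edges}.

Definition degree (v : V) : nat := #|[set w | adj G v w]|.

Definition regular (g : nat) : Prop := forall v, degree v = g.

(* The matrices are indexed through the enumeration of V, that is,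
   v_i = enum_val i. *)
Definition adjmx (R : nzRingType) : 'M[R]_#|V| :=
  \matrix_(i, j) (if adj G (enum_val i) (enum_val j)
                  then (sigma G (enum_val i) (enum_val j))%:~R else 0).

Definition degmx (R : nzRingType) : 'M[R]_#|V| :=
  diag_mx (\row_i (degree (enum_val i))%:R).

Definition lapmx (R : nzRingType) : 'M[R]_#|V| := degmx R - adjmx R.

Record r_orientation := ROrientation {
  theta :> V -> edge -> int;
  theta_out : forall w (e : edge), w \notin val e -> theta w e = 0;
  theta_end : forall w (e : edge), w \in val e -> is_sign (theta w e);
  theta_sigma : forall u v (e : edge), val e = [set u; v] ->
    theta u e * theta v e = sigma G u v
}.

End Graph.

Definition markv (V : finType) (G : marked_graph V) (R : nzRingType) :
  'cV[R]_#|V| := \col_i (mark G (enum_val i))%:~R.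

Lemma is_signM (x y : int) : is_sign x -> is_sign y -> is_sign (x * y).
Proof. by move=> /orP[] /eqP-> /orP[] /eqP->. Qed.

Section Subdivision.

Variables (V : finType) (G : signed_graph V) (th : r_orientation G).

Definition subdiv_adj (x y : V + edge G) : bool :=
  match x, y with
  | inl v, inr e | inr e, inl v => v \in val e
  | _, _ => false
  end.

Definition subdiv_sigma (x y : V + edge G) : int :=
  match x, y with
  | inl v, inr e | inr e, inl v => th v e
  | _, _ => 0
  end.

Lemma subdiv_adj_sym : symmetric subdiv_adj.
Proof. by case=> [v|e] [w|f]. Qed.

Lemma subdiv_adj_irrefl : irreflexive subdiv_adj.
Proof. by case. Qed.

Lemma subdiv_sigma_sym x y : subdiv_sigma x y = subdiv_sigma y x.
Proof. by case: x y => [v|e] [w|f]. Qed.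

Lemma subdiv_sigma_sign x y : subdiv_adj x y -> is_sign (subdiv_sigma x y).
Proof. by case: x y => [v|e] [w|f] //=; apply: theta_end. Qed.

Definition subdivision : signed_graph (V + edge G)%type :=
  SignedGraph subdiv_adj_sym subdiv_adj_irrefl
              subdiv_sigma_sym subdiv_sigma_sign.

End Subdivision.

Section Corona.

Variables (V1 V2 : finType) (G1 : signed_graph V1) (th : r_orientation G1).
Variable G2 : marked_graph V2.

(* inr (t, u) is the vertex u of the t-th copy of G2. *)
Definition corona_vertex : finType := ((V1 + edge G1) + V1 * V2)%type.

Definition corona_adj (x y : corona_vertex) : bool :=
  match x, y with
  | inl a, inl b => adj (subdivision th) a b
  | inl (inr e), inr (t, _) | inr (t, _), inl (inr e) => t \in val e
  | inr (t, u), inr (s, w) => (t == s) && adj G2 u w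
  | _, _ => false
  end.

Definition corona_sigma (x y : corona_vertex) : int :=
  match x, y with
  | inl a, inl b => sigma (subdivision th) a b
  | inl (inr e), inr (t, u) | inr (t, u), inl (inr e) => th t e * mark G2 u
  | inr (_, u), inr (_, w) => sigma G2 u w
  | _, _ => 0
  end.

Lemma corona_adj_sym : symmetric corona_adj.
Proof.
case=> [a|[t u]] [b|[s w]] /=.
- by case: a b => [?|?] [?|?].
- by case: a.
- by case: b.
- by rewrite eq_sym adj_sym.
Qed.

Lemma corona_adj_irrefl : irreflexive corona_adj.
Proof.
case=> [[v|e]|[t u]] //=.
by rewrite adj_irrefl andbF.
Qed.

Lemma corona_sigma_sym x y : corona_sigma x y = corona_sigma y x.
Proof.
case: x y => [a|[t u]] [b|[s w]] /=.
- by case: a b => [?|?] [?|?].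
- by case: a.
- by case: b.
- exact: sigma_sym.
Qed.

Lemma corona_sigma_sign x y : corona_adj x y -> is_sign (corona_sigma x y).
Proof.
case: x y => [a|[t u]] [b|[s w]] /=.
- by case: a b => [?|?] [?|?] //=; apply: theta_end.
- by case: a => // e se; rewrite is_signM ?theta_end ?mark_sign.
- by case: b => // e te; rewrite is_signM ?theta_end ?mark_sign.
- by case/andP=> _; apply: sigma_sign.
Qed.

Definition subdiv_vnbhd_corona : signed_graph corona_vertex :=
  SignedGraph corona_adj_sym corona_adj_irrefl
              corona_sigma_sym corona_sigma_sign.

End Corona.

Notation "x %:F" := (@FracField.tofrac _ x) : ring_scope.

(* Rational functions of one variable are elements of {fraction {poly R}}.
   Poles and values are read off the reduced fraction, so that a removable
   singularity of a representative is not a pole. *)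
Section RationalFunction.

Variable R : fieldType.

Implicit Types (f : {fraction {poly R}}) (a : R) (p q : {poly R}).

Definition ratf_num f : {poly R} :=
  \n_(repr f) %/ gcdp \n_(repr f) \d_(repr f).
Definition ratf_den f : {poly R} :=
  \d_(repr f) %/ gcdp \n_(repr f) \d_(repr f).

Definition ratf_pole f a : bool := root (ratf_den f) a.
Definition ratf_eval f a : R := (ratf_num f).[a] / (ratf_den f).[a].

Lemma ratf_reprE f : f = (\n_(repr f))%:F / (\d_(repr f))%:F.
Proof.
have d0 : \d_(repr f) != 0 := denom_ratioP _.
apply: (canRL (mulfK _)); first by rewrite tofrac_eq0.
have {1}-> : f = \pi_({fraction {poly R}})%qT (repr f) by rewrite reprK.
move: (repr f) d0 => r d0.
unlock FracField.tofrac; rewrite -[LHS]FracField.pi_mul.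
apply/eqmodP; rewrite /= FracField.equivfE /FracField.mulf.
by rewrite !numden_Ratio ?mulf_neq0 ?oner_neq0 // !mulr1 mulrC.
Qed.

Lemma ratf_coprime f : coprimep (ratf_num f) (ratf_den f).
Proof. by rewrite coprimep_div_gcd // denom_ratioP orbT. Qed.

Lemma ratfE f : f = (ratf_num f)%:F / (ratf_den f)%:F.
Proof.
have d0 : \d_(repr f) != 0 := denom_ratioP _.
rewrite [LHS]ratf_reprE /ratf_num /ratf_den; set g := gcdp _ _.
have g0 : g != 0 by rewrite gcdp_eq0 negb_and d0 orbT.
apply/eqP; rewrite eqr_div ?tofrac_eq0 ?dvdp_div_eq0 ?dvdp_gcdr //.
by rewrite -!tofracM tofrac_eq divp_mulCA ?dvdp_gcdr ?dvdp_gcdl // mulrC.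
Qed.

Lemma ratf_den_neq0 f : ratf_den f != 0.
Proof.
have d0 : \d_(repr f) != 0 := denom_ratioP _.
by rewrite dvdp_div_eq0 ?dvdp_gcdr.
Qed.

Lemma ratf_eval_frac p q a : q.[a] != 0 ->
  ~~ ratf_pole (p%:F / q%:F) a /\ ratf_eval (p%:F / q%:F) a = p.[a] / q.[a].
Proof.
move=> qa0; set f := p%:F / q%:F.
have q0 : q != 0 by apply: contraNneq qa0 => ->; rewrite horner0.
have h : p * ratf_den f = ratf_num f * q.
  apply/eqP; rewrite -tofrac_eq !tofracM -eqr_div ?tofrac_eq0 ?ratf_den_neq0 //.
  by rewrite -ratfE.
have ha : p.[a] * (ratf_den f).[a] = (ratf_num f).[a] * q.[a].
  by rewrite -!hornerM h.
have da0 : (ratf_den f).[a] != 0.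
  apply/eqP=> d0; move: ha; rewrite d0 mulr0 => /esym/eqP.
  rewrite mulf_eq0 (negPf qa0) orbF => n0.
  have := coprimep_root (ratf_coprime f) n0.
  by rewrite d0 eqxx.
split; first by rewrite /ratf_pole rootE.
by apply/eqP; rewrite /ratf_eval eqr_div // -ha.
Qed.

End RationalFunction.

(* Sigma_N(X) as an element of the field of rational functions R(X). *)
Definition coronal (R : fieldType) (V : finType) (G : marked_graph V)
    (N : 'M[R]_#|V|) : {fraction {poly R}} :=
  let emb := fun c : R => c%:P%:F in
  let mu := map_mx emb (markv G R) in
  (mu^T *m invmx ('X%:F%:M - map_mx emb N) *m mu) 0 0.

(* The eigenvalues, listed with algebraic multiplicity. *)
Definition eigenvalues_of (R : fieldType) (n : nat) (M : 'M[R]_n)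
    (lam : 'I_n -> R) : Prop :=
  char_poly M = \prod_(j < n) ('X - (lam j)%:P).

(* Main.v *)
(* Order the vertices of the corona as V1, E, V1 x V2 and put y := x - gamma1,
   c := x - 2 - 2 n2, B the incidence matrix of the orientation.  Then x - L is
     [ y    B         0                      ]
     [ B^T  c         B^T (x) mu^T           ]
     [ 0    B (x) mu  I (x) (y - L(Gamma2))  ],
   and two Schur complements reduce its determinant to
   f_{L(Gamma2)}(y)^n1 y^n1 det(c - (Sigma(y) + 1/y) B^T B).  Sylvester's identity
   replaces B^T B by B B^T = 2 gamma1 - L(Gamma1), whose eigenvalues are known.
   This needs y, c and f_{L(Gamma2)}(y) to be invertible, so it is carried out with
   y the indeterminate of R(X); after clearing the reduced denominator of Sigma the
   result is a polynomial identity, which specializes to every x that is not a pole. *)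

Require Import Defs.
From HB Require Import structures.
From mathcomp Require Import all_boot all_order all_algebra.
From mathcomp Require Import perm fraction ring.

Set Implicit Arguments.
Unset Strict Implicit.
Unset Printing Implicit Defensive.

Import Order.TTheory GRing.Theory Num.Theory.
Local Open Scope ring_scope.

(** * Determinants of matrices indexed by finite types *)

(** Entries come from a function on the index types, so that reordering and splitting of indices
    take place on vertices and not on their ranks. *)
Definition fmx (R : Type) (A B : finType) (f : A -> B -> R) : 'M[R]_(#|A|, #|B|) :=
  \matrix_(i, j) f (enum_val i) (enum_val j).

Section FiniteTypeMatrices.

Variable R : comNzRingType.
Implicit Types A B C S T : finType.

Lemma eq_fmx A B (f g : A -> B -> R) : f =2 g -> fmx f = fmx g.
Proof. by move=> fg; apply/matrixP=> i j; rewrite !mxE fg. Qed.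

Lemma sum_enum_val A (F : A -> R) : \sum_(i < #|A|) F (enum_val i) = \sum_a F a.
Proof. by rewrite -(big_enum_val F). Qed.

Lemma fmxM A B C (f : A -> B -> R) (g : B -> C -> R) :
  fmx f *m fmx g = fmx (fun a c => \sum_b f a b * g b c).
Proof.
apply/matrixP=> i j; rewrite !mxE -[RHS]sum_enum_val.
by apply: eq_bigr => k _; rewrite !mxE.
Qed.

Lemma fmxB A B (f g : A -> B -> R) :
  fmx f - fmx g = fmx (fun a b => f a b - g a b).
Proof. by apply/matrixP=> i j; rewrite !mxE. Qed.

Lemma fmx_scalar A (z : R) : z%:M = fmx (fun a b : A => z *+ (a == b)).
Proof. by apply/matrixP=> i j; rewrite !mxE (inj_eq enum_val_inj). Qed.

(** [h] and [enum_val] differ by a permutation that acts on rows and columns alike, so its sign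
    occurs twice and cancels. *)
Lemma det_fmx_ord T n (h : 'I_n -> T) (f : T -> T -> R) : bijective h ->
  \det (fmx f) = \det (\matrix_(i, j) f (h i) (h j)).
Proof.
move=> bij_h; have n_eq : n = #|T| by rewrite -(bij_eq_card bij_h) card_ord.
case: _ / (esym n_eq) h bij_h => h bij_h {n_eq}.
have inj_s : injective (enum_rank \o h).
  exact: inj_comp enum_rank_inj (bij_inj bij_h).
pose s := perm inj_s.
have -> : \matrix_(i, j) f (h i) (h j) = row_perm s (col_perm s (fmx f)).
  by apply/matrixP=> i j; rewrite !mxE !permE /= !enum_rankK.
rewrite row_permE col_permE !det_mulmx !det_perm odd_permV mulrCA.
by rewrite -signr_addb addbb mulr1.
Qed.

Lemma det_fmx_bij S T (h : S -> T) (f : T -> T -> R) : bijective h ->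
  \det (fmx f) = \det (fmx (fun a b => f (h a) (h b))).
Proof.
by move=> bij_h; apply: det_fmx_ord; apply: bij_comp bij_h (enum_val_bij _).
Qed.

(** However [A + B] is enumerated, [det_fmx_ord] allows listing [A] before [B]. *)
Lemma det_fmx_sum A B (f : A + B -> A + B -> R) :
  \det (fmx f) = \det (block_mx
    (fmx (fun a a' => f (inl a) (inl a'))) (fmx (fun a b => f (inl a) (inr b)))
    (fmx (fun b a => f (inr b) (inl a))) (fmx (fun b b' => f (inr b) (inr b')))).
Proof.
pose h (i : 'I_(#|A| + #|B|)) : (A + B)%type :=
  match split i with inl a => inl (enum_val a) | inr b => inr (enum_val b) end.
pose g (x : A + B) : 'I_(#|A| + #|B|) :=
  match x with inl a => lshift _ (enum_rank a) | inr b => rshift _ (enum_rank b) end.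
have bij_h : bijective h.
  exists g => [i|[a|b]]; rewrite /h /g.
  - by case: split_ordP => j ->; rewrite enum_valK.
  - by rewrite (unsplitK (inl _)) enum_rankK.
  - by rewrite (unsplitK (inr _)) enum_rankK.
rewrite (det_fmx_ord _ bij_h); congr (\det _); apply/matrixP=> i j.
by rewrite !mxE /h; case: (split i) => k; rewrite !mxE; case: (split j) => l;
   rewrite mxE.
Qed.

(** The matrix is the Kronecker product of the identity with [g]. Replacing [A] by an ordinal type
    lets an induction peel off one diagonal block at a time. *)
Lemma det_fmx_kron1 A B (g : B -> B -> R) :
  \det (fmx (fun p q : A * B => g p.2 q.2 *+ (p.1 == q.1))) =
  \det (fmx g) ^+ #|A|.
Proof.
pose k n (p q : 'I_n * B) : R := g p.2 q.2 *+ (p.1 == q.1).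
transitivity (\det (fmx (@k #|A|))).
  have bij_h : bijective (fun p : 'I_#|A| * B => (enum_val p.1, p.2)).
    by exists (fun p : A * B => (enum_rank p.1, p.2)) => -[a b] /=;
       rewrite ?enum_valK ?enum_rankK.
  rewrite (det_fmx_bij _ bij_h); congr (\det _); apply: eq_fmx => p q.
  by rewrite /k (inj_eq enum_val_inj).
elim: #|A| => [|n IHn] => [|{A}].
  rewrite expr0; suff p0 : #|{: 'I_0 * B}| = 0%N.
    by move: (fmx _); rewrite p0 => M; rewrite det_mx00.
  by rewrite card_prod card_ord.
pose h (x : B + 'I_n * B) : 'I_n.+1 * B :=
  match x with inl b => (ord0, b) | inr p => (lift ord0 p.1, p.2) end.
pose h' (p : 'I_n.+1 * B) : B + 'I_n * B :=
  if unlift ord0 p.1 is Some i then inr (i, p.2) else inl p.2.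
have bij_h : bijective h.
  exists h' => [[b|[i b]]|[i b]]; rewrite /h /h' /= ?unlift_none ?liftK //.
  by case: unliftP => [j|] ->.
rewrite (det_fmx_bij _ bij_h) det_fmx_sum exprS -IHn.
rewrite [X in block_mx _ X _ _](_ : _ = 0); last first.
  by apply/matrixP=> i j; rewrite !mxE.
by rewrite det_lblock; congr (\det _ * \det _); apply: eq_fmx.
Qed.

End FiniteTypeMatrices.

(** * Schur complements, Sylvester's identity, determinants from eigenvalues *)

Section BlockDeterminants.

Variable R : comNzRingType.

(** [W] stands for the quotient of [C] by [D]: a unipotent column operation built from it clears the
    lower left block. *)
Lemma det_block_schur m n (A : 'M[R]_m) (B : 'M_(m, n)) (C : 'M_(n, m))
    (D : 'M_n) (W : 'M_(n, m)) :
  D *m W = C -> \det (block_mx A B C D) = \det (A - B *m W) * \det D.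
Proof.
move=> DW; rewrite -(det_ublock _ B).
have <- : block_mx A B C D *m block_mx 1%:M 0 (- W) 1%:M =
          block_mx (A - B *m W) B 0 D.
  by rewrite mulmx_block !mulmx1 !mulmx0 !mulmxN DW subrr !add0r.
by rewrite det_mulmx det_lblock !det1 !mulr1.
Qed.

Lemma det_block_schur_ul m n (A : 'M[R]_m) (B : 'M_(m, n)) (C : 'M_(n, m))
    (D : 'M_n) (W : 'M_(m, n)) :
  A *m W = B -> \det (block_mx A B C D) = \det A * \det (D - C *m W).
Proof.
move=> AW; rewrite -(det_lblock _ C).
have <- : block_mx A B C D *m block_mx 1%:M (- W) 0 1%:M =
          block_mx A 0 C (D - C *m W).
  by rewrite mulmx_block !mulmx1 !mulmx0 !mulmxN AW addNr !addr0 addrC.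
by rewrite det_mulmx det_ublock !det1 !mulr1.
Qed.

Lemma horner_char_poly n (M : 'M[R]_n) (z : R) :
  (char_poly M).[z] = \det (z%:M - M).
Proof.
rewrite -[LHS]/(horner_eval _ _) -det_map_mx; congr (\det _).
by apply/matrixP=> i j; rewrite !mxE /= /horner_eval !hornerE hornerMn hornerX.
Qed.

End BlockDeterminants.

Section FieldDeterminants.

Variable F : fieldType.

(** Both sides come from the block matrix with rows [c, B] and [C, 1], expanded by either of its two
    Schur complements. *)
Lemma det_sylvester m n (c : F) (B : 'M_(m, n)) (C : 'M_(n, m)) : c != 0 ->
  c ^+ m * \det (c%:M - C *m B) = c ^+ n * \det (c%:M - B *m C).
Proof.
move=> c0; have := @det_block_schur_ul _ m n c%:M B C 1%:M (c^-1 *: B).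
rewrite (@det_block_schur _ m n _ _ _ _ C (mul1mx C)).
rewrite mul_scalar_mx scalerA mulfV // scale1r => /(_ erefl).
rewrite det1 mulr1 det_scalar => ->.
have -> : c%:M - C *m B = c *: (1%:M - C *m (c^-1 *: B)).
  by rewrite scalerBr scale_scalar_mx mulr1 -scalemxAr scalerA mulfV ?scale1r.
by rewrite detZ mulrCA.
Qed.

(** For nonzero [s] this is the characteristic polynomial at [- a / s], rescaled by [(- s) ^+ n];
    for [s = 0] both sides are [a ^+ n]. *)
Lemma det_affine_eigenvalues n (M : 'M[F]_n) (lam : 'I_n -> F) (a s : F) :
  eigenvalues_of M lam ->
  \det (a%:M + s *: M) = \prod_(j < n) (a + s * lam j).
Proof.
move=> eigM; have [->|s0] := eqVneq s 0.
  rewrite scale0r addr0 det_scalar (eq_bigr (fun=> a)) => [|j _].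
    by rewrite prodr_const card_ord.
  by rewrite mul0r addr0.
have -> : a%:M + s *: M = (- s) *: ((- a / s)%:M - M).
  rewrite scalerBr scale_scalar_mx mulrA mulrNN [s * a]mulrC mulfK //.
  by rewrite scaleNr opprK.
rewrite detZ -horner_char_poly eigM horner_prod.
rewrite -[X in _ ^+ X]card_ord -prodr_const -big_split /=.
apply: eq_bigr => j _; rewrite !hornerE; field; exact: s0.
Qed.

End FieldDeterminants.

(** * Incidence and degrees *)

Lemma is_sign_sqr (x : int) : is_sign x -> x * x = 1.
Proof. by case/orP=> /eqP->. Qed.

Section Incidence.

Variables (V : finType) (G : signed_graph V).

Lemma degreeE (v : V) : degree G v = (\sum_w adj G v w)%N.
Proof. by rewrite /degree -sum1dep_card big_mkcond. Qed.

Lemma adj_neq (u v : V) : adj G u v -> u != v.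
Proof. by apply: contraTneq => ->; rewrite adj_irrefl. Qed.

Lemma edgesP (e : {set V}) :
  reflect (exists u v, adj G u v /\ e = [set u; v]) (e \in edges G).
Proof.
rewrite inE; apply: (iffP existsP) => [[u /existsP[v /andP[uv /eqP->]]]|].
  by exists u, v.
by move=> [u [v [uv ->]]]; exists u; apply/existsP; exists v; rewrite uv eqxx.
Qed.

Lemma card_edge (e : edge G) : #|val e| = 2%N.
Proof. by case/edgesP: (valP e) => u [v [uv ->]]; rewrite cards2 adj_neq. Qed.

Lemma edge_set2 (e : edge G) u v :
  u != v -> u \in val e -> v \in val e -> val e = [set u; v].
Proof.
move=> uv ue ve; apply/esym/eqP; rewrite eqEcard card_edge cards2 uv andbT.
by apply/subsetP=> w /set2P[]->.
Qed.

Lemma adj_edges u v : ([set u; v] \in edges G) = adj G u v.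
Proof.
apply/idP/idP=> [|uv]; last by apply/edgesP; exists u, v.
case/edgesP=> a [b [ab E]].
have : u \in [set a; b] by rewrite -E set21.
have : v \in [set a; b] by rewrite -E set22.
have : a \in [set u; v] by rewrite E set21.
have : b \in [set u; v] by rewrite E set22.
have ba : adj G b a by rewrite adj_sym.
(* The four memberships match the two pairs in one order or the other; degenerate matches would make
   a vertex adjacent to itself. *)
by do 4!(case/set2P=> ?; subst) => //; rewrite ?adj_irrefl in ab ba *.
Qed.

(** Sending a neighbour [w] to [[set v; w]] is a bijection from the neighbours of [v] to the edges
    through [v]. *)
Lemma sum_incident_edges (v : V) : (\sum_(e : edge G) (v \in val e) = degree G v)%N.
Proof.
rewrite /degree -(card_in_imset (f := fun w => [set v; w])); last first.
  move=> a b; rewrite !inE => va vb /setP/(_ a).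
  by rewrite set22 => /esym/set2P[av|//]; rewrite av adj_irrefl in va.
transitivity #|[set e : edge G | v \in val e]|.
  by rewrite -sum1dep_card [RHS]big_mkcond.
rewrite -(card_imset _ val_inj); apply: eq_card => e.
apply/imsetP/imsetP=> [[[f fE]]|[w]]; rewrite inE /=.
  move=> vf ->; case/edgesP: (fE) vf => a [b [ab ->]] /set2P[->|->].
    by exists b; rewrite ?inE.
  by exists a; rewrite ?inE 1?adj_sym // setUC.
rewrite -adj_edges => vw ->; exists (Sub [set v; w] vw) => //.
by rewrite inE /= set21.
Qed.

End Incidence.

(** * The incidence matrix of an orientation *)

Section IncidenceMatrix.

Variables (V : finType) (G : signed_graph V) (th : r_orientation G).
Variable R : comNzRingType.

Definition incmx : 'M[R]_(#|V|, #|edge G|) := fmx (fun v e => (th v e)%:~R).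

Lemma theta_sqr (v : V) (e : edge G) : th v e * th v e = (v \in val e)%:R.
Proof.
case: (boolP (v \in val e)) => [/(theta_end th)/is_sign_sqr->//|].
by move/(theta_out th)=> ->.
Qed.

(** On the diagonal the squares count incident edges. Off it, only the edge joining [u] and [v] can
    contribute, and the orientation axiom gives its sign. *)
Lemma sum_thetaM u v : \sum_(e : edge G) th u e * th v e =
  (degree G u)%:R *+ (u == v) + (if adj G u v then sigma G u v else 0).
Proof.
have [<-|uv] := eqVneq u v.
  rewrite adj_irrefl addr0 -sum_incident_edges natr_sum.
  by apply: eq_bigr => e _; rewrite theta_sqr.
have th0 (e : edge G) : val e != [set u; v] -> th u e * th v e = 0.
  apply: contraNeq; rewrite mulf_eq0 negb_or => /andP[ue ve].
  apply/eqP/edge_set2 => //.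
    by apply: contraNT ue => /(theta_out th)->.
  by apply: contraNT ve => /(theta_out th)->.
rewrite add0r; case: ifP; rewrite -adj_edges => uvE; last first.
  apply: big1 => e _; apply: th0; apply: contraFneq uvE => <-; exact: valP.
pose e0 : edge G := Sub [set u; v] uvE.
rewrite (bigD1 e0) //= big1 => [|e ee0]; first by rewrite addr0; apply: theta_sigma.
by apply: th0; apply: contraNneq ee0 => E; apply/eqP/val_inj.
Qed.

Lemma incmx_mul_tr : incmx *m incmx^T = degmx G R + adjmx G R.
Proof.
have -> : incmx^T = fmx (fun e v => (th v e)%:~R).
  by apply/matrixP=> i j; rewrite !mxE.
rewrite fmxM; apply/matrixP=> i j; rewrite !mxE.
under eq_bigr do rewrite -intrM.
rewrite -(rmorph_sum intr) sum_thetaM (inj_eq enum_val_inj) rmorphD /=; congr (_ + _).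
  by rewrite rmorphMn /= rmorph_nat.
by case: ifP.
Qed.

Lemma scalar_sub_lapmx (z : R) : z%:M - lapmx G R =
  fmx (fun u v => (z - (degree G u)%:R) *+ (u == v)
                  + (if adj G u v then (sigma G u v)%:~R else 0)).
Proof.
apply/matrixP=> i j; rewrite !mxE (inj_eq enum_val_inj) mulrnBl.
by rewrite opprB addrA addrAC.
Qed.

End IncidenceMatrix.

(** * Vertex degrees in the corona *)

Section CoronaDegrees.

Variables (V1 V2 : finType) (G1 : signed_graph V1) (th : r_orientation G1).
Variable G2 : marked_graph V2.
Let GC := subdiv_vnbhd_corona th G2.

Lemma corona_degree_vertex v : degree GC (inl (inl v)) = degree G1 v.
Proof.
rewrite degreeE !big_sumType /= !big1_eq addn0 add0n.
exact: sum_incident_edges.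
Qed.

(** An inserted vertex sees its two endpoints and all vertices of the two copies attached to
    them. *)
Lemma corona_degree_edge e : degree GC (inl (inr e)) = (2 + 2 * #|V2|)%N.
Proof.
have sum_e : (\sum_(v : V1) (v \in val e) = 2)%N.
  by rewrite -(card_edge e) -sum1_card [RHS]big_mkcond.
rewrite degreeE !big_sumType /= !big1_eq addn0 sum_e; congr (_ + _)%N.
transitivity (\sum_(p : V1 * V2) (p.1 \in val e))%N.
  by apply: eq_bigr => -[].
rewrite -(pair_bigA _ (fun t _ => nat_of_bool (t \in val e))) /= exchange_big /=.
by rewrite sum_nat_const sum_e mulnC.
Qed.

Lemma corona_degree_copy t u :
  degree GC (inr (t, u)) = (degree G1 t + degree G2 u)%N.
Proof.
rewrite degreeE !big_sumType /= !big1_eq add0n -sum_incident_edges; congr (_ + _)%N.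
transitivity (\sum_(p : V1 * V2) ((t == p.1) && adj G2 u p.2))%N.
  by apply: eq_bigr => -[].
rewrite -(pair_bigA _ (fun s w => nat_of_bool ((t == s) && adj G2 u w))) /=.
rewrite (bigD1 t) //= [X in (_ + X)%N]big1 => [|s st].
  by rewrite addn0 eqxx degreeE.
by rewrite big1 // => w _; rewrite eq_sym (negPf st).
Qed.

End CoronaDegrees.

(** * The corona Laplacian *)

(** The factor [y ^+ m] is moved inside the determinant to clear the [1/y] in the value
    [k = S + 1/y] for which this is applied. *)
Lemma det_scalar_sub_eigenvalues (F : fieldType) m n (c k y d : F)
    (B : 'M[F]_(m, n)) (L : 'M[F]_m) (lam : 'I_m -> F) :
  eigenvalues_of L lam -> B *m B^T = d%:M - L ->
  y ^+ m * \det (c%:M - k *: (B *m B^T)) =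
  \prod_(j < m) (y * c - y * k * (d - lam j)).
Proof.
move=> eigL ->; rewrite -detZ.
have -> : y *: (c%:M - k *: (d%:M - L)) =
          (y * c - y * k * d)%:M + (y * k) *: L.
  by apply/matrixP=> i j; rewrite !mxE; case: (i == j); rewrite ?mulr1n ?mulr0n; ring.
rewrite (det_affine_eigenvalues _ _ eigL).
by apply: eq_bigr => j _; ring.
Qed.

Section CoronaDeterminant.

Variables (V1 V2 : finType) (G1 : signed_graph V1) (th : r_orientation G1).
Variables (G2 : marked_graph V2) (g : nat).
Hypothesis regG1 : regular G1 g.

Lemma lapmx_regular (R : comNzRingType) :
  incmx th R *m (incmx th R)^T = (2 * g%:R)%:M - lapmx G1 R.
Proof.
have degE : degmx G1 R = g%:R%:M.
  by rewrite -diag_const_mx; congr diag_mx; apply/rowP=> i; rewrite !mxE regG1.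
rewrite incmx_mul_tr /lapmx degE opprB mulr_natl mulr2n raddfD /=.
by rewrite [adjmx _ _ - _]addrC addrA addrK.
Qed.

Variable F : fieldType.
Variable y : F.
Let c : F := y + g%:R - 2 - 2 * #|V2|%:R.
Let N : 'M[F]_#|V2| := y%:M - lapmx G2 F.
Let S : F := ((markv G2 F)^T *m invmx N *m markv G2 F) 0 0.
Let B := incmx th F.

Hypothesis N_unit : N \in unitmx.

(** First Schur complement: all copies of the second graph are eliminated at once, which changes
    only the block of inserted vertices. *)
Lemma det_corona_schur :
  \det ((y + g%:R)%:M - lapmx (subdiv_vnbhd_corona th G2) F) =
  \det (block_mx y%:M B B^T (c%:M - S *: (B^T *m B))) * \det N ^+ #|V1|.
Proof.
pose nf (u v : V2) : F := (y - (degree G2 u)%:R) *+ (u == v)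
  + (if adj G2 u v then (sigma G2 u v)%:~R else 0).
have NE : N = fmx nf by rewrite /N scalar_sub_lapmx.
have N_val i j : N i j = nf (enum_val i) (enum_val j) by rewrite NE mxE.
(* The solution of [N w = mu], indexed by vertices. *)
pose w (u : V2) : F := (invmx N *m markv G2 F) (enum_rank u) 0.
have nf_w u : \sum_v nf u v * w v = (mark G2 u)%:~R.
  have := mulKVmx N_unit (markv G2 F).
  move/matrixP/(_ (enum_rank u) 0); rewrite [RHS]mxE enum_rankK => <-.
  rewrite [RHS]mxE -sum_enum_val; apply: eq_bigr => i _.
  by rewrite N_val enum_rankK /w enum_valK.
have mark_w : \sum_u (mark G2 u)%:~R * w u = S.
  rewrite /S -mulmxA [RHS]mxE -sum_enum_val; apply: eq_bigr => i _.
  by rewrite /w enum_valK !mxE.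
(* The block of the copies is the identity tensor [N], so solving against the coupling block
   replaces [mu] by [w]. *)
pose W := fmx (fun (p : V1 * V2) (x : V1 + edge G1) =>
  match x with inl _ => 0 | inr e => (th p.1 e)%:~R * w p.2 end).
rewrite scalar_sub_lapmx; set f := (X in fmx X).
have f_vv v v' : f (inl (inl v)) (inl (inl v')) = y *+ (v == v').
  by rewrite /f corona_degree_vertex regG1 addrK addr0.
have f_ve v e : f (inl (inl v)) (inl (inr e)) = (th v e)%:~R.
  rewrite /f add0r /=; case: ifP => // /negbT /(theta_out th) ->.
  by rewrite mulr0z.
have f_ev e v : f (inl (inr e)) (inl (inl v)) = (th v e)%:~R.
  rewrite /f add0r /=; case: ifP => // /negbT /(theta_out th) ->.
  by rewrite mulr0z.
have f_ee e e' : f (inl (inr e)) (inl (inr e')) = c *+ (e == e').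
  by rewrite /f corona_degree_edge addr0 natrD natrM opprD addrA.
have f_vc v p : f (inl (inl v)) (inr p) = 0.
  by rewrite /f add0r; case: p.
have f_cv p v : f (inr p) (inl (inl v)) = 0.
  by rewrite /f add0r; case: p.
have f_ec e p : f (inl (inr e)) (inr p) = (th p.1 e)%:~R * (mark G2 p.2)%:~R.
  rewrite /f add0r; case: p => t u /=; rewrite -intrM.
  by case: ifP => // /negbT /(theta_out th) ->; rewrite mul0r.
have f_ce p e : f (inr p) (inl (inr e)) = (th p.1 e)%:~R * (mark G2 p.2)%:~R.
  rewrite /f add0r; case: p => t u /=; rewrite -intrM.
  by case: ifP => // /negbT /(theta_out th) ->; rewrite mul0r.
have f_cc p q : f (inr p) (inr q) = nf p.2 q.2 *+ (p.1 == q.1).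
  case: p q => t u [s v]; rewrite /f /nf corona_degree_copy regG1 /=.
  rewrite natrD opprD addrA addrK.
  (* Injectivity of [inr] by a left inverse; its value [(t, u)] on [inl] is an arbitrary default. *)
  rewrite (inj_eq (can_inj (g := fun x => if x is inr z then z else (t, u)) _)) //.
  rewrite xpair_eqE; have [_|_] := eqVneq t s; rewrite ?mulr0n ?addr0 //.
rewrite det_fmx_sum (eq_fmx f_cc).
rewrite (det_block_schur _ _ (W := W)); last first.
  rewrite fmxM; apply: eq_fmx => -[t u] [v|e].
    by rewrite f_cv big1 // => p _; rewrite mulr0.
  rewrite f_ce -(pair_bigA _ (fun s v => nf u v *+ (t == s) * ((th s e)%:~R * w v))) /=.
  rewrite (bigD1 t) //= [X in _ + X]big1 => [|s st]; last first.
    by rewrite big1 // => v _; rewrite eq_sym (negPf st) mulr0n mul0r.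
  rewrite addr0 -nf_w mulr_sumr; apply: eq_bigr => v _.
  by rewrite eqxx mulrCA.
rewrite det_fmx_kron1 -NE; congr (_ * _).
rewrite fmxM fmxB det_fmx_sum; congr (\det (block_mx _ _ _ _)).
- rewrite fmx_scalar; apply: eq_fmx => v v'; rewrite f_vv big1 ?subr0 // => p _.
  by rewrite mulr0.
- apply: eq_fmx => v e; rewrite f_ve big1 ?subr0 // => p _.
  by rewrite f_vc mul0r.
- apply/matrixP=> i j; rewrite !mxE f_ev big1 ?subr0 // => p _.
  by rewrite mulr0.
have -> : B^T = fmx (fun e v => (th v e)%:~R).
  by apply/matrixP=> i j; rewrite !mxE.
rewrite fmxM fmx_scalar; apply/matrixP=> i j; rewrite !mxE f_ee; congr (_ - _).
(* The sum over pairs [(t, u)] factors into an entry of [B^T *m B] and the sum of [mark * w], which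
   is [S]. *)
rewrite -mark_w mulr_suml.
under [RHS]eq_bigr do rewrite mulr_sumr.
rewrite exchange_big pair_bigA /=; apply: eq_bigr => p _.
by rewrite f_ec; ring.
Qed.

Hypothesis y_neq0 : y != 0.
Hypothesis c_neq0 : c != 0.

(** Second Schur complement, on the original vertices, followed by Sylvester's identity. Powers of
    [c] stay on both sides, as the difference of their exponents may be negative. *)
Lemma det_corona (lam : 'I_#|V1| -> F) : eigenvalues_of (lapmx G1 F) lam ->
  \det ((y + g%:R)%:M - lapmx (subdiv_vnbhd_corona th G2) F) * c ^+ #|V1| =
  c ^+ #|edge G1| * \det N ^+ #|V1| *
  \prod_(j < #|V1|) (y * c - (1 + y * S) * (2 * g%:R - lam j)).
Proof.
have schur := det_corona_schur; have BBt : B *m B^T = _ := lapmx_regular F.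
rewrite schur; clearbody c S B N; move=> eigL {schur}.
rewrite (det_block_schur_ul _ _ (W := y^-1 *: B)); last first.
  by rewrite mul_scalar_mx scalerA mulfV ?scale1r.
have -> : c%:M - S *: (B^T *m B) - B^T *m (y^-1 *: B) =
          c%:M - ((S + y^-1) *: B^T) *m B.
  by rewrite -scalemxAr -scalemxAl scalerDl opprD addrA.
have := det_sylvester B ((S + y^-1) *: B^T) c_neq0; rewrite -scalemxAr.
have := det_scalar_sub_eigenvalues c (S + y^-1) y eigL BBt.
rewrite mulrDr mulfV // [y * S + 1]addrC => <-; rewrite det_scalar.
move: (\det (c%:M - _)) => d syl.
rewrite -mulrA mulrACA [d * _]mulrC syl mulrACA [RHS]mulrACA.
by rewrite [y ^+ _ * _]mulrC.
Qed.

End CoronaDeterminant.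

(** * Specialization from the field of rational functions *)

(** Clears the denominator of the coronal [p / q] in one bracket of the product; applied in the
    field of rational functions and again after evaluation. *)
Lemma mulr_clear_denom (F : fieldType) (p q u v w : F) : q != 0 ->
  (u - (1 + v * (p / q)) * w) * q = q * u - (q + v * p) * w.
Proof. by move=> q0; field. Qed.

Lemma map_lapmx (R S : nzRingType) (f : {rmorphism R -> S}) (V : finType)
    (G : signed_graph V) : map_mx f (lapmx G R) = lapmx G S.
Proof.
apply/matrixP=> i j; rewrite !mxE rmorphB rmorphMn /= rmorph_nat; congr (_ - _).
by case: ifP; rewrite ?rmorph0 ?rmorph_int.
Qed.

Lemma map_markv (R S : nzRingType) (f : {rmorphism R -> S}) (V : finType)
    (G : marked_graph V) : map_mx f (markv G R) = markv G S.
Proof. by apply/matrixP=> i j; rewrite !mxE rmorph_int. Qed.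

Lemma map_eigenvalues_of (R S : fieldType) (f : {rmorphism R -> S}) n
    (M : 'M[R]_n) (lam : 'I_n -> R) :
  eigenvalues_of M lam -> eigenvalues_of (map_mx f M) (f \o lam).
Proof.
rewrite /eigenvalues_of -map_char_poly => ->; rewrite rmorph_prod.
by apply: eq_bigr => j _; rewrite rmorphB /= map_polyX map_polyC.
Qed.

Lemma polyX_add_const_neq0 (R : idomainType) (a b m : nat) :
  'X + a%:R - b%:R - 2 * m%:R != 0 :> {poly R}.
Proof.
have -> : 'X + a%:R - b%:R - 2 * m%:R = 'X - (b%:R + 2 * m%:R - a%:R)%:P :> {poly R}.
  by rewrite !(rmorphB, rmorphD, rmorphM, rmorph_nat) /=; ring.
by rewrite polyXsubC_eq0.
Qed.

Section RationalFunctions.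

Variable R : fieldType.
Let K : fieldType := {fraction {poly R}}.
Let emb : {rmorphism R -> K} := (@FracField.tofrac {poly R}) \o polyC.

Lemma coronalE (V : finType) (G : marked_graph V) :
  coronal G (lapmx G R) =
  ((markv G K)^T *m invmx (('X%:F)%:M - lapmx G K) *m markv G K) 0 0.
Proof. by rewrite -(map_lapmx emb) -(map_markv emb). Qed.

Lemma tofrac_char_poly n (M : 'M[R]_n) :
  (char_poly M)%:F = \det (('X%:F)%:M - map_mx emb M).
Proof.
rewrite -det_map_mx; congr (\det _); rewrite map_mxB map_scalar_mx.
by congr (_ - _); rewrite -map_mx_comp.
Qed.

(** With [a] the degree of the first graph, the shift makes the argument of the coronal the
    indeterminate. *)
Lemma tofrac_comp_char_poly n (M : 'M[R]_n) (a : R) :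
  (char_poly M \Po ('X + a%:P))%:F = \det (('X%:F + emb a)%:M - map_mx emb M).
Proof.
rewrite -[char_poly M \Po _]/(comp_poly _ _) -!det_map_mx; congr (\det _).
apply/matrixP=> i j; rewrite !mxE /= rmorphB rmorphMn /= comp_polyX comp_polyC.
by rewrite rmorphB rmorphMn rmorphD.
Qed.

Variables (V1 V2 : finType) (G1 : signed_graph V1) (th : r_orientation G1).
Variables (G2 : marked_graph V2) (g : nat) (lam : 'I_#|V1| -> R).
Hypotheses (regG1 : regular G1 g) (eigG1 : eigenvalues_of (lapmx G1 R) lam).

Let Sigma := coronal G2 (lapmx G2 R).
Let p := ratf_num Sigma.
Let q := ratf_den Sigma.
Let c : {poly R} := 'X + g%:R - 2 - 2 * #|V2|%:R.

(** [det_corona] over the rational functions with [y] the indeterminate, multiplied by [q ^+ #|V1|].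
    All terms are then polynomials, and [tofrac] is injective. *)
Lemma corona_char_poly :
  (char_poly (lapmx (subdiv_vnbhd_corona th G2) R) \Po ('X + g%:R%:P))
    * c ^+ #|V1| * q ^+ #|V1| =
  c ^+ #|edge G1| * char_poly (lapmx G2 R) ^+ #|V1| *
  \prod_(j < #|V1|) (q * ('X * c) - (q + 'X * p) * (2 * g%:R - (lam j)%:P)).
Proof.
have q0 : q%:F != 0 by rewrite tofrac_eq0 ratf_den_neq0.
have c0 : c != 0 by apply: polyX_add_const_neq0.
have cE : c%:F = 'X%:F + g%:R - 2 - 2 * #|V2|%:R.
  by rewrite /c !(rmorphB, rmorphD, rmorphM, rmorph_nat).
(* The determinant is a characteristic polynomial, hence monic and nonzero. *)
have N_unit : ('X%:F)%:M - lapmx G2 K \in unitmx.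
  rewrite unitmxE unitfE -(map_lapmx emb) -tofrac_char_poly tofrac_eq0.
  exact: monic_neq0 (char_poly_monic _).
have X0 : 'X%:F != 0 :> K by rewrite tofrac_eq0 polyX_eq0.
have eigK : eigenvalues_of (lapmx G1 K) (emb \o lam).
  by rewrite -(map_lapmx emb); apply: map_eigenvalues_of.
have := det_corona th regG1 N_unit X0 _ eigK.
rewrite -cE -coronalE -/Sigma [Sigma]ratfE -/p -/q tofrac_eq0 => /(_ c0).
rewrite -(map_lapmx emb (subdiv_vnbhd_corona th G2)) -(rmorph_nat emb g).
rewrite -tofrac_comp_char_poly -(map_lapmx emb G2) -tofrac_char_poly => E.
clearbody p q c.
apply/eqP; rewrite -tofrac_eq !rmorphM !rmorphXn /= E -!mulrA.
apply/eqP; do 2!congr (_ * _).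
rewrite rmorph_prod /= -[X in _ ^+ X]card_ord -prodr_const -big_split /=.
apply: eq_bigr => j _.
rewrite (mulr_clear_denom _ _ _ _ q0) tofracB !tofracM tofracB tofracD !tofracM.
by rewrite !rmorph_nat.
Qed.

End RationalFunctions.

(** The polynomial identity is evaluated at [x - gamma1]. [hdef] keeps the formula meaningful by
    excluding a negative power of zero. *)
Theorem theorem5p5 (R : numFieldType) (V1 V2 : finType)
    (Gamma1 : marked_graph V1) (Gamma2 : marked_graph V2)
    (theta : r_orientation Gamma1) (gamma1 n1 m1 n2 : nat)
    (hn1 : n1 = #|V1|) (hm1 : m1 = #|edges Gamma1|) (hn2 : n2 = #|V2|)
    (hreg : regular Gamma1 gamma1)
    (lam : 'I_#|V1| -> R) (hlam : eigenvalues_of (lapmx Gamma1 R) lam)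
    (x : R)
    (hpole : ~~ ratf_pole (coronal Gamma2 (lapmx Gamma2 R)) (x - gamma1%:R))
    (hdef : x - 2 - 2 * n2%:R != 0 \/ (n1 <= m1)%N) :
  let S := ratf_eval (coronal Gamma2 (lapmx Gamma2 R)) (x - gamma1%:R) in
  (char_poly (lapmx (subdiv_vnbhd_corona theta Gamma2) R)).[x] =
    (x - 2 - 2 * n2%:R) ^ (m1%:Z - n1%:Z)
    * (char_poly (lapmx Gamma2 R)).[x - gamma1%:R] ^+ n1
    * \prod_(j < #|V1|)
        (x ^+ 2 - (gamma1%:R + 2 + 2 * n2%:R) * x
         + 2 * gamma1%:R * (n2%:R + 1)
         - (1 + (x - gamma1%:R) * S) * (2 * gamma1%:R - lam j)).
Proof.
move=> S; have E := corona_char_poly theta Gamma2 hreg hlam.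
have m1E : m1 = #|edge Gamma1| by rewrite hm1 card_sig.
rewrite hn2 in hdef *; rewrite -m1E in E.
have SE : S = (ratf_num (coronal Gamma2 (lapmx Gamma2 R))).[x - gamma1%:R] /
              (ratf_den (coronal Gamma2 (lapmx Gamma2 R))).[x - gamma1%:R] by [].
move: E hpole SE; rewrite /ratf_pole rootE; clearbody S.
move: (char_poly _) (char_poly _) (ratf_num _) (ratf_den _) => L2 P p q.
set c : {poly R} := 'X + _ - _ - _; set Pi := \prod_(j < _) _.
set Pr := (X in _ -> _ -> _ -> _ = _ * X).
set a := x - gamma1%:R => E qa SE.
have ca : c.[a] = x - 2 - 2 * #|V2|%:R.
  by rewrite /c /a -!polyC_natr !hornerE; ring.
have c0 : c != 0 by apply: polyX_add_const_neq0.
clearbody c.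
(* One factor [q.[a]] goes to each of the [n1] brackets. *)
have Pia : Pi.[a] = q.[a] ^+ n1 * Pr.
  rewrite horner_prod hn1 -[X in _ ^+ X]card_ord -prodr_const -big_split /=.
  apply: eq_bigr => j _; rewrite -!polyC_natr.
  rewrite !(hornerM, hornerD, hornerN, hornerX, hornerC) ca SE -/a.
  rewrite [RHS]mulrC -mulr_clear_denom //; congr ((_ - _) * _).
  by rewrite /a; ring.
have Pa : (P \Po ('X + gamma1%:R%:P)).[a] = P.[x].
  by rewrite horner_comp !hornerE /a subrK.
move: E; rewrite -hn1 -ca in hdef *; clearbody Pi Pr a => E.
(* Since [a] is not a pole, [q.[a]] is nonzero and can be cancelled. *)
apply: (mulIf (expf_neq0 n1 qa)).
(* If [n1 <= m1], then [c ^+ n1] is cancelled between polynomials before evaluation, because [c.[a]]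
   may be zero. Otherwise [hdef] makes [c.[a]] invertible. *)
have [le_nm|lt_mn] := leqP n1 m1.
  have {E} : (P \Po ('X + gamma1%:R%:P)) * q ^+ n1 = c ^+ (m1 - n1) * L2 ^+ n1 * Pi.
    apply: (mulIf (expf_neq0 n1 c0)); rewrite mulrAC in E.
    by rewrite E -{1}(subnK le_nm) exprD; ring.
  move/(congr1 (horner^~ a)); rewrite /= !hornerM !horner_exp Pa Pia => ->.
  by rewrite subzn // -exprnP; ring.
have {hdef} ca0 : c.[a] != 0 by case: hdef => //; rewrite leqNgt lt_mn.
apply: (mulIf (expf_neq0 n1 ca0)).
move/(congr1 (horner^~ a)): E; rewrite /= !hornerM !horner_exp Pa Pia.
rewrite mulrAC => ->; rewrite expfzDr // -exprnP -invr_expz -exprnP.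
have := expf_neq0 n1 ca0; move: (c.[a] ^+ n1) (c.[a] ^+ m1) => d e d0.
by field.
Qed.
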